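(* Let $Y$ be a continuous Lagrangian path on $[a,b]$ and let $S(t)$ be a continuous (real $2n\times2n$) symplectic matrix function on $[a,b]$. Then $$\mathcal N(S^{-1}Y,[a,b])=\mathcal N(Z_{SE}^{-1}Y,[a,b]),\qquad \mathcal N^*(S^{-1}Y,[a,b])=\mathcal N^*(Z_{SE}^{-1}Y,[a,b]),$$ where $Z_{SE}(t)=\begin{pmatrix}\mathcal J S(t)E\,K(t)& S(t)E\,K(t)\end{pmatrix}$ with $K(t)=[(S(t)E)^TS(t)E]^{-1/2}$ is the symplectic and orthogonal matrix associated with the Lagrangian path $S(t)E$.
   Context: Notation. $n\in\mathbb N$, $[a,b]\subseteq\mathbb R$, $\mathcal J=\begin{pmatrix}0&I\\ -I&0\end{pmatrix}\in\mathbb R^{2n\times2n}$, $E=\begin{pmatrix}0\\ I\end{pmatrix}\in\mathbb R^{2n\times n}$. A real $2n\times 2n$ matrix $S$ is symplectic if $S^T\mathcal JS=\mathcal J$. A Lagrangian plane is a constant $Y\in\mathbb R^{2n\times n}$ with $Y^T\mathcal JY=0$ and $\operatorname{rank}Y=n$. A continuous Lagrangian path on $[a,b]$ is a continuous $Y:[a,b]\to\mathbb R^{2n\times n}$ such that every $Y(t)$ is a Lagrangian plane. We write $Y=\begin{pmatrix}X\\ U\end{pmatrix}$ with $n\times n$ blocks (similarly $\hat Y$ with $\hat X,\hat U$). The Wronskian is $W(Y,\hat Y)=Y^T\mathcal J\hat Y$. Comparative index. For Lagrangian planes $Y,\hat Y$ put $\mathcal M=(I-X^\dagger X)W(Y,\hat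 Y)$, $V=I-\mathcal M^\dagger\mathcal M$, $\mathcal P=V[W(Y,\hat Y)]^TX^\dagger\hat XV$ (a symmetric matrix), where $\dagger$ is the Moore–Penrose pseudoinverse. The comparative index and dual comparative index are $\mu(Y,\hat Y)=\operatorname{rank}\mathcal M+\operatorname{ind}\mathcal P$, $\mu^*(Y,\hat Y)=\operatorname{rank}\mathcal M+\operatorname{ind}(-\mathcal P)$, with $\operatorname{ind}$ the number of negative eigenvalues. Oscillation numbers. For a continuous Lagrangian path $Y$ on $[a,b]$ take a partition $a=t_0<t_1<\dots<t_p=b$ and real symplectic matrix functions $R_k(t)$, $k=0,\dots,p-1$, with $R_k$ continuous on $[t_k,t_{k+1}]$ and such that, for each $k$, both $\operatorname{rank}W(R_k(t)E,Y(t))$ and $\operatorname{rank}\big((I\ \,0)R_k(t)E\big)$ are constant for $t\in[t_k,t_{k+1}]$. Then $$\mathcal N(Y,[a,b]):=\sum_{k=0}^{p-1}\big[\mu(Y(t_{k+1}),R_k(t_{k+1})E)-\mu(Y(t_k),R_k(t_k)E)\big],$$ $$\mathcal N^*(Y,[a,b]):=\sum_{k=0}^{p-1}\big[\mu^*(Y(t_k),R_k(t_k)E)-\mu^*(Y(t_{k+1}),R_k(t_{k+1})E)\big].$$ Such partitions and systems exist and the values do not depend on their choice. *)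

(* Defs.v *)
From mathcomp Require Import all_boot all_order all_algebra.
From mathcomp Require Import all_classical all_reals all_analysis.
From mathcomp Require Import polyrcf.

Set Implicit Arguments.
Unset Strict Implicit.
Unset Printing Implicit Defensive.

Import Order.TTheory GRing.Theory Num.Theory.
Import numFieldNormedType.Exports.
Local Open Scope classical_set_scope.
Local Open Scope ring_scope.

Section Matrices.
Context {R : realType}.

Definition penrose m n (A : 'M[R]_(m, n)) (X : 'M[R]_(n, m)) : Prop :=
  [/\ A *m X *m A = A, X *m A *m X = X,
      (A *m X)^T = A *m X & (X *m A)^T = X *m A].

(* The Moore-Penrose pseudoinverse; [penrose_unique] and [pinvP] show that it
   is the unique solution of the Penrose equations.  It differs from [pinvmx]
   of mxalgebra, which is only some generalized inverse. *)
Definition pinv m n (A : 'M[R]_(m, n)) : 'M[R]_(n, m) :=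
  xget 0 [set X | penrose A X].

Lemma penrose_unique m n (A : 'M[R]_(m, n)) (X1 X2 : 'M[R]_(n, m)) :
  penrose A X1 -> penrose A X2 -> X1 = X2.
Proof.
move=> [a1 b1 c1 d1] [a2 b2 c2 d2].
have e1 : A *m X1 = A *m X2.
  rewrite -c1 -{1}a2 -(mulmxA (A *m X2)) trmx_mul c1 c2.
  by rewrite -mulmxA (mulmxA X1) mulmxA mulmxA a1.
have e2 : X1 *m A = X2 *m A.
  rewrite -d1 -{1}a2 -mulmxA mulmxA trmx_mul d1.
  by rewrite d2 -mulmxA (mulmxA A) a1.
by rewrite -b1 e2 -mulmxA e1 mulmxA b2.
Qed.

Lemma gram_unitmx m r (C : 'M[R]_(m, r)) :
  \rank C = r -> C^T *m C \in unitmx.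
Proof.
move=> rC; rewrite -row_free_unit -kermx_eq0; apply/rowV0P => v /sub_kermxP.
move=> vCC; have vC0 : v *m C^T = 0.
  have /matrixP/(_ 0 0) : (v *m C^T) *m (v *m C^T)^T = 0.
    by rewrite trmx_mul trmxK mulmxA -(mulmxA v) vCC mul0mx.
  rewrite !mxE => /eqP; rewrite psumr_eq0 => [/allP h|i _].
    apply/rowP => i; rewrite [RHS]mxE; apply/eqP.
    by have := h i (mem_index_enum _); rewrite /= [X in _ * X]mxE mulf_eq0 orbb.
  by rewrite [X in _ * X]mxE -expr2 sqr_ge0.
have /row_free_inj : row_free C^T by rewrite /row_free mxrank_tr rC.
by move=> /(_ _ v 0); apply; rewrite mul0mx.
Qed.

Lemma penrose_factor m n r (C : 'M[R]_(m, r)) (F : 'M[R]_(r, n)) :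
  \rank C = r -> \rank F = r -> exists X, penrose (C *m F) X.
Proof.
move=> rC rF.
have CU : C^T *m C \in unitmx by apply: gram_unitmx.
have FU : F *m F^T \in unitmx.
  by rewrite -{1}[F]trmxK; apply: gram_unitmx; rewrite mxrank_tr.
pose G := F^T *m invmx (F *m F^T); pose H := invmx (C^T *m C) *m C^T.
have FG : F *m G = 1%:M by rewrite mulmxA mulmxV.
have HC : H *m C = 1%:M by rewrite -mulmxA mulVmx.
have AX : C *m F *m (G *m H) = C *m H.
  by rewrite -mulmxA (mulmxA F) FG mul1mx.
have XA : G *m H *m (C *m F) = G *m F.
  by rewrite -mulmxA (mulmxA H) HC mul1mx.
exists (G *m H); split.
- by rewrite AX -mulmxA (mulmxA H) HC mul1mx.
- by rewrite XA -mulmxA (mulmxA F) FG mul1mx.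
- by rewrite AX /H !trmx_mul trmx_inv trmx_mul !trmxK mulmxA.
- by rewrite XA /G !trmx_mul trmx_inv trmx_mul !trmxK mulmxA.
Qed.

Lemma pinvP m n (A : 'M[R]_(m, n)) : penrose A (pinv A).
Proof.
apply: (@xgetPex _ 0 [set X | penrose A X]).
have /eqP rC := col_base_full A; have /eqP rF := row_base_free A.
by have := penrose_factor rC rF; rewrite mulmx_base.
Qed.

(* The number of negative eigenvalues, counted with multiplicity. *)
Definition ind n (P : 'M[R]_n) : nat :=
  (\sum_(x <- rootsR (char_poly P) | (x < 0)%R) mup x (char_poly P))%N.

Definition psdmx n (B : 'M[R]_n) : Prop :=
  B^T = B /\ forall v : 'cV[R]_n, 0 <= (v^T *m B *m v) 0 0.

(* The positive semidefinite square root of a positive semidefinite matrix. *)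
Definition sqrtmx n (A : 'M[R]_n) : 'M[R]_n :=
  xget 0 [set B | psdmx B /\ B *m B = A].

End Matrices.

Section Symplectic.
Context {R : realType} {n : nat}.
Implicit Types (S : 'M[R]_(n + n)) (Y : 'M[R]_(n + n, n)).

Definition Jmx : 'M[R]_(n + n) := block_mx 0 1%:M (- 1%:M) 0.
Definition Emx : 'M[R]_(n + n, n) := col_mx 0 1%:M.

Definition symplectic S : Prop := S^T *m Jmx *m S = Jmx.

Definition lagrangian Y : Prop := Y^T *m Jmx *m Y = 0 /\ \rank Y = n.

Definition lagrangian_path (a b : R) (Y : R -> 'M[R]_(n + n, n)) : Prop :=
  {within `[a, b], continuous Y} /\ forall t, t \in `[a, b] -> lagrangian (Y t).

Definition wronskian Y1 Y2 : 'M[R]_n := Y1^T *m Jmx *m Y2.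

Definition comp_M Y1 Y2 : 'M[R]_n :=
  (1%:M - pinv (usubmx Y1) *m usubmx Y1) *m wronskian Y1 Y2.

Definition comp_V Y1 Y2 : 'M[R]_n :=
  1%:M - pinv (comp_M Y1 Y2) *m comp_M Y1 Y2.

Definition comp_P Y1 Y2 : 'M[R]_n :=
  comp_V Y1 Y2 *m (wronskian Y1 Y2)^T *m pinv (usubmx Y1) *m usubmx Y2
    *m comp_V Y1 Y2.

Definition comp_index Y1 Y2 : nat :=
  (\rank (comp_M Y1 Y2) + ind (comp_P Y1 Y2))%N.

Definition dual_comp_index Y1 Y2 : nat :=
  (\rank (comp_M Y1 Y2) + ind (- comp_P Y1 Y2))%N.

(* The symplectic orthogonal matrix associated with a Lagrangian plane. *)
Definition Zmx Y : 'M[R]_(n + n) :=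
  let K := invmx (sqrtmx (Y^T *m Y)) in row_mx (Jmx *m Y *m K) (Y *m K).

End Symplectic.

Section Oscillation.
Context {R : realType} {n : nat}.
Implicit Types (Y : R -> 'M[R]_(n + n, n)) (Rs : nat -> R -> 'M[R]_(n + n)).

(* The list [s] = [:: t_1; ...; t_p] encodes a = t_0 < t_1 < ... < t_p = b. *)
Definition node (a : R) (s : seq R) (k : nat) : R := nth a (a :: s) k.

Definition osc_system Y (a b : R) (s : seq R) Rs : Prop :=
  itv_partition a b s /\
  forall k, (k < size s)%N ->
    let I := `[node a s k, node a s k.+1] in
    [/\ forall t, t \in I -> symplectic (Rs k t),
        {within [set` I], continuous (Rs k)},
        forall t u, t \in I -> u \in I ->
          \rank (wronskian (Rs k t *m Emx) (Y t)) =
          \rank (wronskian (Rs k u *m Emx) (Y u)) &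
        forall t u, t \in I -> u \in I ->
          \rank (usubmx (Rs k t *m Emx)) = \rank (usubmx (Rs k u *m Emx))].

Definition osc_sum Y (a : R) (s : seq R) Rs : int :=
  \sum_(k < size s)
    let t0 := node a s k in let t1 := node a s k.+1 in
    ((comp_index (Y t1) (Rs k t1 *m Emx))%:Z
     - (comp_index (Y t0) (Rs k t0 *m Emx))%:Z).

Definition dual_osc_sum Y (a : R) (s : seq R) Rs : int :=
  \sum_(k < size s)
    let t0 := node a s k in let t1 := node a s k.+1 in
    ((dual_comp_index (Y t0) (Rs k t0 *m Emx))%:Z
     - (dual_comp_index (Y t1) (Rs k t1 *m Emx))%:Z).

(* For a continuous Lagrangian path the sets below are singletons: admissible
   systems exist and the sum does not depend on the system. *)
Definition osc Y (a b : R) : int :=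
  xget 0 [set N | exists s Rs, osc_system Y a b s Rs /\ N = osc_sum Y a s Rs].

Definition dual_osc Y (a b : R) : int :=
  xget 0
    [set N | exists s Rs, osc_system Y a b s Rs /\ N = dual_osc_sum Y a s Rs].

End Oscillation.

(* Main.v *)
(* Both transformations differ by the symplectic path [L = Z^-1 S], and
   [S E = Z E K^-1] says that [L] is block lower triangular.  Such an [L]
   multiplies upper blocks by an invertible matrix and preserves Wronskians, so
   [R_k |-> L R_k] is a bijection between the admissible systems of [S^-1 Y]
   and of [Z^-1 Y]; moreover it leaves the matrices [M] and [P] of the
   comparative index literally unchanged, hence the sums agree term by term.
   The analytic ingredient is the continuity of [Z], that is, of the positive
   semidefinite square root. *)
Require Import Defs.
From mathcomp Require Import all_boot all_order all_algebra.
From mathcomp Require Import all_classical all_reals all_analysis.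
From mathcomp Require Import ring complex spectral.
Import Order.TTheory GRing.Theory Num.Theory.
Import numFieldNormedType.Exports.
Local Open Scope classical_set_scope.
Local Open Scope ring_scope.

(* [mathcomp.classical.functions] has its own [pinv]. *)
Local Notation pinv := Defs.pinv.

Set Implicit Arguments.
Unset Strict Implicit.
Unset Printing Implicit Defensive.

(** * Existence of positive semidefinite square roots *)

Lemma poly_interpolation (F : fieldType) (f : F -> F) (s : seq F) :
  exists p : {poly F}, {in s, forall x, p.[x] = f x}.
Proof.
elim: s => [|a s [p hp]]; first by exists 0.
have [as_|aNs] := boolP (a \in s).
  by exists p => x; rewrite inE => /predU1P[->|]; apply: hp.
pose m : {poly F} := \prod_(b <- s) ('X - b%:P).
have ma : m.[a] != 0 by rewrite -[_ == 0]/(root m a) root_prod_XsubC.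
(* Newton's form: [m] vanishes on [s], so adding a multiple of it corrects the value at [a]
   alone. *)
exists (p + ((f a - p.[a]) / m.[a])%:P * m) => x.
rewrite inE !hornerE => /predU1P[->|xs]; first by rewrite divfK// addrC subrK.
have /eqP -> : m.[x] == 0 by rewrite -[_ == 0]/(root m x) root_prod_XsubC.
by rewrite mulr0 addr0 hp.
Qed.

Section SquareRoot.
Context {R : realType}.

Lemma trmx_horner_mx n (A : 'M[R]_n.+1) p : A^T = A ->
  (horner_mx A p)^T = horner_mx A p.
Proof.
move=> tA; elim/poly_ind: p => [|p c ih]; first by rewrite rmorph0 trmx0.
rewrite rmorphD rmorphM /= horner_mx_X horner_mx_C linearD /= tr_scalar_mx.
rewrite -mulmxE trmx_mul tA ih; congr (_ + _).
by apply/esym; exact: comm_horner_mx.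
Qed.

(** Rayleigh quotient: a left eigenvector [v] satisfies [v A v^T = a (v v^T)] with [v v^T > 0]. *)
Lemma psdmx_eigenvalue_ge0 n (A : 'M[R]_n) a :
  psdmx A -> eigenvalue A a -> 0 <= a.
Proof.
move=> [tA hA] /eigenvalueP[v vA v0].
have := hA v^T; rewrite trmxK vA -scalemxAl mxE.
have vv_ge0 : 0 <= (v *m v^T) 0 0.
  by rewrite mxE sumr_ge0// => i _; rewrite mxE -expr2 sqr_ge0.
suff vv_neq0 : (v *m v^T) 0 0 != 0 by rewrite pmulr_lge0// lt0r vv_neq0.
apply: contra v0; rewrite mxE psumr_eq0 => [/allP h|i _]; last first.
  by rewrite mxE -expr2 sqr_ge0.
apply/eqP/rowP => i; rewrite [RHS]mxE; apply/eqP.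
by have := h i (mem_index_enum _); rewrite /= [X in _ * X]mxE mulf_eq0 orbb.
Qed.

(* Over the complex numbers [A = P^-1 D P] with [D] real diagonal, so a real
   polynomial taking each eigenvalue to its fourth root gives [Q] with
   [Q ^ 4 = A]; then [Q ^ 2] is the required root. *)
Lemma psdmx_sqrt n (A : 'M[R]_n) : psdmx A -> exists B, psdmx B /\ B *m B = A.
Proof.
case: n A => [|n] A hA.
  exists 0; split; last by rewrite mulmx0; apply/matrixP => -[].
  by split=> [|v]; rewrite ?trmx0// mulmx0 mul0mx mxE.
have [tA _] := hA.
pose toC : {rmorphism R -> R[i]} := real_complex R; pose AC := map_mx toC A.
have AChermi : AC \is hermsymmx.
  apply/is_hermitianmxP; rewrite expr0 scale1r; apply/matrixP => i j.
  by rewrite !mxE -[in LHS]tA mxE; apply/esym/CrealP/complex_realP; eexists.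
have /hermitian_normalmx/orthomx_spectralP AE := AChermi.
have /mxOverP Dreal := hermitian_spectral_diag_real AChermi.
set P := spectralmx AC in AE; set D := spectral_diag AC in AE Dreal.
have uP : P \in unitmx by exact: spectral_unit.
pose d i := complex.Re (D 0 i).
have dE i : D 0 i = toC (d i).
  by have /complex_realP[x xE] := Dreal 0 i; rewrite /d xE.
(* The rows of [P] are left eigenvectors of [AC], nonzero since [P] is invertible; the real
   eigenvalue [d i] descends to [A] through the characteristic polynomial. *)
have d_ge0 i : 0 <= d i.
  apply: (psdmx_eigenvalue_ge0 hA); rewrite eigenvalue_root_char.
  rewrite -(fmorph_root toC) map_char_poly -/AC -dE -eigenvalue_root_char.
  apply/eigenvalueP; exists (row i P).
    by rewrite AE -row_mul !mulmxA mulmxV// mul1mx row_mul row_diag_mx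
      -scalemxAl -rowE.
  apply/eqP => Pi0; have /matrixP/(_ i i)/eqP := mulmxV uP.
  have -> : (P *m invmx P) i i = row i (P *m invmx P) 0 i by rewrite [RHS]mxE.
  by rewrite row_mul Pi0 mul0mx !mxE eqxx eq_sym oner_eq0.
(* Fourth roots make the candidate root [Q Q = Q^T Q], whose quadratic form is a sum of squares. *)
have [p hp] := poly_interpolation (fun x => Num.sqrt (Num.sqrt x)) (codom d).
pose Q := horner_mx A p.
have tQ : Q^T = Q by exact: trmx_horner_mx.
exists (Q *m Q); split.
  split=> [|v]; first by rewrite trmx_mul tQ.
  rewrite -{1}tQ mulmxA -trmx_mul -mulmxA mxE sumr_ge0// => i _.
  by rewrite mxE -expr2 sqr_ge0.
(* This is checked over the complex numbers, where [p ^+ 4 - 'X] vanishes at every diagonal entry of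
   [D], and descends because [toC] is injective. *)
have : horner_mx A (p ^+ 4 - 'X) = 0.
  apply: (map_mx_inj (f := toC)); rewrite map_mx0 map_horner_mx -/AC AE.
  rewrite (horner_mx_uconjC _ _ uP) horner_mx_diag.
  suff -> : map_mx (horner (map_poly toC (p ^+ 4 - 'X))) D = 0.
    by rewrite linear0 mulmx0 mul0mx.
  apply/rowP => i; rewrite !mxE dE horner_map /= !hornerE.
  rewrite hp ?codom_f// (exprM _ 2 2) !sqr_sqrtr ?sqrtr_ge0// subrr.
  exact: rmorph0.
rewrite rmorphB rmorphXn /= horner_mx_X => /eqP; rewrite subr_eq0 => /eqP <-.
by rewrite -/Q mulmxE -!expr2 -exprM.
Qed.

Lemma sqrtmxP n (A : 'M[R]_n) : psdmx A ->
  psdmx (sqrtmx A) /\ sqrtmx A *m sqrtmx A = A.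
Proof.
move=> hA; exact: (@xgetPex _ 0 [set B | psdmx B /\ B *m B = A]
  (psdmx_sqrt hA)).
Qed.
End SquareRoot.

(** * Projectors built from the pseudoinverse *)

Section Pinv.
Context {R : realType}.

Lemma tr_pinv_mul m n (A : 'M[R]_(m, n)) : (pinv A *m A)^T = pinv A *m A.
Proof. by have [] := pinvP A. Qed.

Lemma tr_mul_pinv m n (A : 'M[R]_(m, n)) : (A *m pinv A)^T = A *m pinv A.
Proof. by have [] := pinvP A. Qed.

Lemma mul_pinvK m n (A : 'M[R]_(m, n)) : A *m pinv A *m A = A.
Proof. by have [] := pinvP A. Qed.

(* Both sides are the orthogonal projector along [ker X = ker (A X)]. *)
Lemma pinv_mul_unit m n (A : 'M[R]_m) (X : 'M[R]_(m, n)) : A \in unitmx ->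
  pinv (A *m X) *m (A *m X) = pinv X *m X.
Proof.
move=> uA; set P1 := pinv (A *m X) *m (A *m X); set P2 := pinv X *m X.
have e12 : P1 *m P2 = P1.
  by rewrite /P1 /P2 -!mulmxA (mulmxA X) mul_pinvK.
have e21 : P2 *m P1 = P2.
  rewrite /P1 /P2 -mulmxA; congr (_ *m _); apply: (can_inj (mulKmx uA)).
  by rewrite !mulmxA -(mulmxA _ A X) mul_pinvK.
(* Both projectors are symmetric, so transposing [P1 P2 = P1] gives [P2 P1 = P1], while [e21] says
   [P2 P1 = P2]. *)
have : (P1 *m P2)^T = P1^T by rewrite e12.
by rewrite trmx_mul /P1 /P2 !tr_pinv_mul -/P1 -/P2 e21 => ->.
Qed.

End Pinv.

(** * Symplectic algebra and invariance of the comparative index *)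

Section Invariance.
Context {R : realType} {n : nat}.
Implicit Types (S : 'M[R]_(n + n)) (Y : 'M[R]_(n + n, n)).

Lemma JmxM : Jmx *m Jmx = - 1%:M :> 'M[R]_(n + n).
Proof.
rewrite /Jmx mulmx_block.
rewrite !(mul0mx, mulmx0, mulmxN, mulNmx, mul1mx, add0r, addr0).
by rewrite (@scalar_mx_block _ n n) opp_block_mx !oppr0.
Qed.

Lemma trJmx : Jmx^T = - Jmx :> 'M[R]_(n + n).
Proof.
rewrite /Jmx tr_block_mx opp_block_mx linearN /=.
by rewrite !(trmx0, trmx1, oppr0, opprK).
Qed.

Lemma unitmx_Jmx : (Jmx : 'M[R]_(n + n)) \in unitmx.
Proof.
have : (- Jmx) *m Jmx = 1%:M :> 'M[R]_(n + n) by rewrite mulNmx JmxM opprK.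
by case/mulmx1_unit.
Qed.

Lemma symplectic_unit S : symplectic S -> S \in unitmx.
Proof.
move=> hS; have := unitmx_Jmx.
by rewrite -hS unitmx_mul => /andP[].
Qed.

Lemma symplectic_mul S1 S2 :
  symplectic S1 -> symplectic S2 -> symplectic (S1 *m S2).
Proof.
by move=> h1 h2; rewrite /symplectic -[RHS]h2 -[in RHS]h1 trmx_mul !mulmxA.
Qed.

Lemma symplectic_inv S : symplectic S -> symplectic (invmx S).
Proof.
move=> hS; have uS := symplectic_unit hS.
rewrite /symplectic -[in LHS]hS !mulmxA -trmx_mul mulmxV// trmx1 mul1mx.
by rewrite mulmxK.
Qed.

Lemma usubmx_lower_mul (L : 'M[R]_(n + n)) p (A : 'M[R]_(n + n, p)) :
  ursubmx L = 0 -> usubmx (L *m A) = ulsubmx L *m usubmx A.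
Proof.
move=> L0; rewrite -{1}[L]submxK L0 -{1}[A]vsubmxK mul_block_col mul0mx addr0.
by rewrite col_mxKu.
Qed.

Lemma ulsubmx_unit (L : 'M[R]_(n + n)) :
  L \in unitmx -> ursubmx L = 0 -> ulsubmx L \in unitmx.
Proof.
move=> uL L0; move: uL; rewrite -{1}[L]submxK L0 !unitmxE det_lblock unitrM.
by case/andP.
Qed.

Lemma mulmx_Emx S : S *m Emx = rsubmx S.
Proof.
by rewrite -{1}[S]hsubmxK mul_row_col mulmx0 add0r mulmx1.
Qed.

Lemma ursubmx_Emx S : ursubmx S = usubmx (S *m Emx).
Proof. by rewrite mulmx_Emx; apply/matrixP => i j; rewrite !mxE. Qed.

Lemma wronskian_symplectic L Y1 Y2 : symplectic L ->
  wronskian (L *m Y1) (L *m Y2) = wronskian Y1 Y2.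
Proof.
by move=> hL; rewrite /wronskian -[in RHS]hL trmx_mul !mulmxA.
Qed.

(** The column space of [Y] lies in its own orthogonal complement for [Jmx]. That complement has
    dimension [2n - n = n], so the two coincide. *)
Lemma lagrangian_complete Y p (v : 'M[R]_(n + n, p)) :
  lagrangian Y -> Y^T *m Jmx *m v = 0 -> exists T, v = Y *m T.
Proof.
case=> hY rY hv.
have uJ := unitmx_Jmx.
have sub : (Y^T <= kermx (Jmx *m Y))%MS by apply/sub_kermxP; rewrite mulmxA.
have eqr : \rank Y^T == \rank (kermx (Jmx *m Y)).
  by rewrite mxrank_tr mxrank_ker (eqmxMfull _ _) ?row_full_unit// rY addnK.
rewrite (mxrank_leqif_eq sub) in eqr.
have /submxP[D eD] : (v^T <= Y^T)%MS.
  rewrite (eqmxP eqr); apply/sub_kermxP/trmx_inj.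
  by rewrite trmx0 !trmx_mul trmxK trJmx mulmxN mulNmx hv oppr0.
by exists D^T; apply/trmx_inj; rewrite trmx_mul trmxK.
Qed.

Section Comparison.
Variables Y1 Y2 : 'M[R]_(n + n, n).
Hypothesis hY1 : lagrangian Y1.
Local Notation X := (usubmx Y1).
Local Notation X2 := (usubmx Y2).
Local Notation W := (wronskian Y1 Y2).
Local Notation V := (comp_V Y1 Y2).

Lemma wronskianE : W = X^T *m dsubmx Y2 - (dsubmx Y1)^T *m X2.
Proof.
rewrite /wronskian -{1}[Y1]vsubmxK -{1}[Y2]vsubmxK tr_col_mx /Jmx.
rewrite mul_row_block !(mulmx0, mulmx1, mulmxN, add0r, addr0).
by rewrite mul_row_col mulNmx addrC.
Qed.

(** [V] is the orthogonal projector onto the kernel of [comp_M Y1 Y2], and on that kernel [W] takes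
    its values in the range of [pinv X *m X]. *)
Lemma wronskian_comp_V : pinv X *m X *m W *m V = W *m V.
Proof.
have : comp_M Y1 Y2 *m V = 0.
  by rewrite /comp_V mulmxBr mulmx1 mulmxA mul_pinvK subrr.
rewrite {1}/comp_M; move: W V => w v.
by rewrite !mulmxBl mul1mx => /eqP; rewrite subr_eq0 => /eqP.
Qed.

(* [ker X^T] is the image of [ker X] under the lower block of [Y1] because
   [Y1] is Lagrangian; on it [X2 V] vanishes by [wronskian_comp_V]. *)
Lemma usubmx_comp_V : X *m pinv X *m (X2 *m V) = X2 *m V.
Proof.
set Q := 1%:M - X *m pinv X.
suff : Q *m (X2 *m V) = 0.
  by rewrite mulmxBl mul1mx => /eqP; rewrite subr_eq0 => /eqP.
have trQ : Q^T = Q by rewrite /Q linearB /= trmx1 tr_mul_pinv.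
have XQ : X^T *m Q = 0.
  by rewrite -trQ -trmx_mul /Q mulmxBl mul1mx mul_pinvK subrr trmx0.
(* The columns of [(0; Q)] are orthogonal to [Y1] for [Jmx] because [X^T Q = 0]; hence [Q = U T]
   with [X T = 0], where [U] is the lower block of [Y1]. *)
have [|T eT] := @lagrangian_complete Y1 _ (col_mx 0 Q) hY1.
  rewrite -{1}[Y1]vsubmxK tr_col_mx /Jmx.
  rewrite mul_row_block !(mulmx0, mulmx1, mulmxN, add0r, addr0).
  by rewrite mul_row_col mulmx0 add0r XQ.
have [XT UT] : 0 = X *m T /\ Q = dsubmx Y1 *m T.
  by apply: eq_col_mx; rewrite -mul_col_mx vsubmxK.
rewrite -trQ UT trmx_mul -mulmxA (mulmxA _ X2).
have -> : (dsubmx Y1)^T *m X2 = X^T *m dsubmx Y2 - W.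
  by rewrite wronskianE opprB addrC subrK.
(* Since [pinv X *m X] is symmetric, [W V] also factors through [X^T] on the left, and [T^T X^T = 0]
   kills both terms. *)
rewrite mulmxBl -wronskian_comp_V -(tr_pinv_mul X) trmx_mul -!mulmxA -mulmxBr.
by rewrite mulmxA -trmx_mul -XT trmx0 mul0mx.
Qed.

Lemma trmx_comp_V : V^T = V.
Proof. by rewrite /comp_V linearB /= trmx1 tr_pinv_mul. Qed.

(** Apart from the Wronskian, only the projector [pinv X *m X] enters, and it does not change when
    [X] is multiplied on the left by an invertible block. *)
Lemma comp_M_lower L : symplectic L -> ursubmx L = 0 ->
  comp_M (L *m Y1) (L *m Y2) = comp_M Y1 Y2.
Proof.
move=> hL L0; have uA := ulsubmx_unit (symplectic_unit hL) L0.
rewrite /comp_M usubmx_lower_mul// pinv_mul_unit//; congr (_ *m _).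
exact: wronskian_symplectic.
Qed.

(** Replacing [X2 V] by [X (pinv X) X2 V] makes the block [A] of [L] appear only inside
    [pinv (A X) *m (A X)], which equals [pinv X *m X]. *)
Lemma comp_P_lower L : symplectic L -> ursubmx L = 0 ->
  comp_P (L *m Y1) (L *m Y2) = comp_P Y1 Y2.
Proof.
move=> hL L0; have := ulsubmx_unit (symplectic_unit hL) L0.
set A := ulsubmx L => uA.
have eV : comp_V (L *m Y1) (L *m Y2) = V.
  by rewrite /comp_V comp_M_lower.
have eW : wronskian (L *m Y1) (L *m Y2) = W.
  exact: wronskian_symplectic.
rewrite /comp_P eV eW !usubmx_lower_mul// -/A.
have VW : V *m W^T = V *m W^T *m (pinv X *m X).
  rewrite -{1}trmx_comp_V -trmx_mul -wronskian_comp_V -mulmxA trmx_mul.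
  rewrite tr_pinv_mul.
  by rewrite trmx_mul trmx_comp_V.
rewrite VW -!mulmxA -usubmx_comp_V; congr (_ *m (_ *m _)).
rewrite (mulmxA A) (mulmxA A) (mulmxA (pinv (A *m X))) (mulmxA (pinv (A *m X))).
by rewrite pinv_mul_unit// !mulmxA.
Qed.
End Comparison.

Lemma lagrangian_symplectic S Y :
  symplectic S -> lagrangian Y -> lagrangian (S *m Y).
Proof.
move=> hS [YJ rY]; split.
  by have := wronskian_symplectic Y Y hS; rewrite /wronskian YJ.
by rewrite (eqmxMfull _ _) ?row_full_unit ?symplectic_unit.
Qed.

Lemma lagrangian_Emx S : symplectic S -> lagrangian (S *m Emx).
Proof.
move=> hS; apply: lagrangian_symplectic => //; split.
  by rewrite tr_col_mx mul_row_block mul_row_col !(trmx0, trmx1, mul0mx, mulmx0,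
    mul1mx, mulmx1, addr0, add0r).
rewrite -mxrank_tr tr_col_mx trmx0 trmx1.
by apply/eqP/row_freeP; exists (col_mx 0 1%:M);
   rewrite mul_row_col mul0mx mul1mx add0r.
Qed.

(** * The symplectic frame of a Lagrangian plane *)

Section Frame.
Variable Y : 'M[R]_(n + n, n).
Hypothesis hY : lagrangian Y.
Local Notation K := (invmx (sqrtmx (Y^T *m Y))).

Lemma psdmx_gram : psdmx (Y^T *m Y).
Proof.
split=> [|v]; first by rewrite trmx_mul trmxK.
rewrite mulmxA -trmx_mul -mulmxA mxE sumr_ge0// => i _.
by rewrite mxE -expr2 sqr_ge0.
Qed.

Lemma sqrtmx_gram_unit : sqrtmx (Y^T *m Y) \in unitmx.
Proof.
have [_ BB] := sqrtmxP psdmx_gram; have [_ rY] := hY.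
by have := gram_unitmx rY; rewrite -{1}BB unitmx_mul => /andP[].
Qed.

(** Up to sign, the blocks of [Z^T J Z] are [K Y^T Y K], equal to 1 by the choice of [K], and
    [K Y^T J Y K], equal to 0 because [Y] is isotropic. *)
Lemma symplectic_Zmx : symplectic (Zmx Y).
Proof.
have [[tB _] BB] := sqrtmxP psdmx_gram; have uB := sqrtmx_gram_unit.
have [YJY _] := hY; rewrite /symplectic /Zmx.
set B := sqrtmx _ in tB BB uB *; set k := invmx B.
have tK : k^T = k by rewrite trmx_inv tB.
have KGK : k *m (Y^T *m Y) *m k = 1%:M.
  by rewrite -BB mulmxA mulVmx// mul1mx mulmxV.
have YJYK : k *m (Y^T *m Jmx *m Y) *m k = 0 by rewrite YJY mulmx0 mul0mx.
rewrite tr_row_mx !trmx_mul tK trJmx mul_col_mx mul_col_row.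
rewrite !mulmxN !mulNmx.
have JJ (A : 'M[R]_(n, n + n)) : A *m Jmx *m Jmx = - A.
  by rewrite -mulmxA JmxM mulmxN mulmx1.
move: KGK YJYK; rewrite !mulmxA => KGK YJYK.
by rewrite !JJ !(mulmxN, mulNmx) !opprK KGK YJYK.
Qed.

Lemma Zmx_Emx : Zmx Y *m Emx = Y *m K.
Proof. by rewrite mulmx_Emx row_mxKr. Qed.
End Frame.
End Invariance.

(** * Limits of matrix-valued functions along a filter *)

Section MatrixLimits.
Context {R : realType} {T : Type} (F : set_system T) {FF : Filter F}.

Lemma cvg_mxP m n (f : T -> 'M[R]_(m, n)) (l : 'M[R]_(m, n)) :
  f x @[x --> F] --> l <-> forall i j, f x i j @[x --> F] --> l i j.
Proof.
split=> [fl i j|fl].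
  apply: (@continuous_cvg _ _ _ F FF f (fun M : 'M[R]_(m, n) => M i j) l) fl.
  exact: coord_continuous.
apply/cvgrPdist_lt => e e0.
have : \forall x \near F, forall ij : 'I_m * 'I_n,
    `|l ij.1 ij.2 - f x ij.1 ij.2| < e.
  apply: filter_forall => -[i j]; by have /cvgrPdist_lt/(_ _ e0) := fl i j.
apply: filterS => x h.
rewrite -/(mx_norm _) mx_normrE; apply/bigmax_ltP; split=> // ij _.
by rewrite !mxE.
Qed.

Lemma cvg_mulmx m n p (f : T -> 'M[R]_(m, n)) (g : T -> 'M[R]_(n, p))
    (A : 'M[R]_(m, n)) (B : 'M[R]_(n, p)) :
  f x @[x --> F] --> A -> g x @[x --> F] --> B ->
  (f x *m g x) @[x --> F] --> A *m B.
Proof.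
move=> /cvg_mxP fA /cvg_mxP gB; apply/cvg_mxP => i j; rewrite mxE.
under eq_cvg do rewrite mxE.
by apply: cvg_big => [|k _]; [exact: add_continuous|exact: cvgM].
Qed.

Lemma cvg_trmx m n (f : T -> 'M[R]_(m, n)) (A : 'M[R]_(m, n)) :
  f x @[x --> F] --> A -> (f x)^T @[x --> F] --> A^T.
Proof.
move=> /cvg_mxP fA; apply/cvg_mxP => i j; rewrite mxE.
under eq_cvg do rewrite mxE.
exact: fA.
Qed.

Lemma cvg_row_mx m n p (f : T -> 'M[R]_(m, n)) (g : T -> 'M[R]_(m, p))
    (A : 'M[R]_(m, n)) (B : 'M[R]_(m, p)) :
  f x @[x --> F] --> A -> g x @[x --> F] --> B ->
  row_mx (f x) (g x) @[x --> F] --> row_mx A B.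
Proof.
move=> /cvg_mxP fA /cvg_mxP gB; apply/cvg_mxP => i j; rewrite mxE.
under eq_cvg do rewrite mxE.
by case: (fintype.split j) => k; [exact: fA|exact: gB].
Qed.

Lemma cvg_det n (f : T -> 'M[R]_n) (A : 'M[R]_n) :
  f x @[x --> F] --> A -> \det (f x) @[x --> F] --> \det A.
Proof.
move=> /cvg_mxP fA; apply: cvg_big => [|s _]; first exact: add_continuous.
apply: cvgMr; apply: cvg_big => [|i _]; [exact: mul_continuous|exact: fA].
Qed.

(** Cramer's formula gives the limit; eventual invertibility keeps [invmx] away from its default
    value, the matrix itself. *)
Lemma cvg_invmx n (f : T -> 'M[R]_n) (A : 'M[R]_n) : A \in unitmx ->
  f x @[x --> F] --> A -> (\forall x \near F, f x \in unitmx) ->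
  invmx (f x) @[x --> F] --> invmx A.
Proof.
move=> uA fA uf.
have /near_eq_cvg : {near F, (fun x => (\det (f x))^-1 *: \adj (f x)) =1
    (fun x => invmx (f x))}.
  by apply: filterS uf => x ux; rewrite /invmx ux.
move/cvg_trans; apply.
rewrite /invmx uA; apply: cvgZ.
  by apply: cvgV; [rewrite -unitfE -unitmxE|exact: cvg_det].
move/cvg_mxP : fA => fA; apply/cvg_mxP => i j; rewrite mxE.
under eq_cvg do rewrite mxE.
apply: cvgMr; apply: cvg_det; apply/cvg_mxP => k l; rewrite !mxE.
under eq_cvg do rewrite !mxE.
exact: fA.
Qed.

End MatrixLimits.

(** * Continuity of the square root at invertible matrices *)

Section SquareRootDistance.
Context {R : realType}.

Lemma coord_mx_norm m n (A : 'M[R]_(m, n)) i j : `|A i j| <= `|A|.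
Proof.
by rewrite -[leRHS]/(mx_norm _) mx_normrE; exact: (le_bigmax _ _ (i, j)).
Qed.

Lemma mx_norm_le m n (A : 'M[R]_(m, n)) c :
  0 <= c -> (forall i j, `|A i j| <= c) -> `|A| <= c.
Proof.
move=> c0 Ac; rewrite -[leLHS]/(mx_norm _) mx_normrE.
by apply/bigmax_leP; split=> // ij _; exact: Ac.
Qed.

Lemma mulmx_coord_le m n p (A : 'M[R]_(m, n)) (B : 'M[R]_(n, p)) i j :
  `|(A *m B) i j| <= n%:R * (`|A| * `|B|).
Proof.
rewrite mxE (le_trans (ler_norm_sum _ _ _))//.
rewrite -[n in n%:R]card_ord -sum1_card natr_sum mulr_suml ler_sum// => k _.
by rewrite mul1r normrM ler_pM// coord_mx_norm.
Qed.

Lemma sqr_coord_le_mxtrace m n (A : 'M[R]_(m, n)) i j :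
  A i j ^+ 2 <= \tr (A^T *m A).
Proof.
have sq k : (A^T *m A) k k = \sum_l A l k ^+ 2.
  by rewrite mxE; apply: eq_bigr => l _; rewrite mxE expr2.
rewrite /mxtrace (bigD1 j)//= sq (bigD1 i)//= -addrA ler_wpDr// addr_ge0//.
  by rewrite sumr_ge0// => k _; exact: sqr_ge0.
by rewrite sumr_ge0// => k _; rewrite sq sumr_ge0// => l _; exact: sqr_ge0.
Qed.

(* With [D = B - B0], [tr (D (B^2 - B0^2)) = tr (D B D) + tr (D B0 D)], where
   the first term is nonnegative and the second is the sum of the squares of
   the entries of [C D]. *)
Lemma psdmx_sqrt_dist n (B B0 C : 'M[R]_n) :
  psdmx B -> B0^T = B0 -> C^T = C -> C *m C = B0 -> C \in unitmx ->
  `|B - B0| <= n%:R ^+ 4 * `|invmx C| ^+ 2 * `|B *m B - B0 *m B0|.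
Proof.
move=> [tB hB] tB0 tC CC uC; set D := B - B0; set E := B *m B - B0 *m B0.
have tD : D^T = D by rewrite /D linearB /= tB tB0.
have DE : D *m E = D *m B *m D + D *m D *m B0.
  rewrite -!mulmxA -mulmxDr; congr (_ *m _).
  by rewrite /D mulmxBr mulmxBl addrA subrK.
have trDE : \tr (D *m E) = \tr (D *m B *m D) + \tr ((C *m D)^T *m (C *m D)).
  rewrite DE mxtraceD; congr (_ + _).
  by rewrite -mulmxA mxtrace_mulC trmx_mul tD tC -CC !mulmxA.
(* The trace of [D B D] is nonnegative, as its diagonal entries are the form of [B] at the columns
   of [D]. *)
have trDE_ge i j : ((C *m D) i j) ^+ 2 <= \tr (D *m E).
  rewrite trDE ler_wpDl ?sqr_coord_le_mxtrace//.
  rewrite sumr_ge0// => k _.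
  have := hB (col k D); rewrite tr_col tD -row_mul colE mulmxA -colE -row_mul.
  by rewrite !mxE.
have trDE_le : \tr (D *m E) <= n%:R ^+ 2 * (`|D| * `|E|).
  rewrite expr2 -mulrA -{1}[n in n%:R]card_ord -sum1_card natr_sum mulr_suml.
  rewrite ler_sum// => k _; rewrite mul1r.
  exact: le_trans (ler_norm _) (mulmx_coord_le _ _ _ _).
have c_ge0 : 0 <= n%:R ^+ 2 * (`|D| * `|E|) by rewrite !mulr_ge0.
have CD_le : `|C *m D| <= Num.sqrt (n%:R ^+ 2 * (`|D| * `|E|)).
  apply: mx_norm_le => [|i j]; first exact: sqrtr_ge0.
  by rewrite -sqrtr_sqr ler_wsqrtr// (le_trans (trDE_ge i j)).
have D_le : `|D| <= n%:R * (`|invmx C| * Num.sqrt (n%:R ^+ 2 * (`|D| * `|E|))).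
  apply: mx_norm_le => [|i j]; first by rewrite !mulr_ge0// sqrtr_ge0.
  rewrite -[D in X in X <= _](mulKmx uC) (le_trans (mulmx_coord_le _ _ _ _))//.
  by rewrite ler_wpM2l// ler_wpM2l.
(* Squaring [D_le] bounds [|D| ^ 2] by a multiple of [|D| |E|], and one factor [|D|] cancels. In
   [n ^ 4], one [n ^ 2] comes from the trace and the other from the product of [invmx C] with
   [C D]. *)
have [->|D0] := eqVneq `|D| 0; first by rewrite !mulr_ge0.
have D_gt0 : 0 < `|D| by rewrite lt0r D0 /=.
rewrite -(ler_pM2l D_gt0) -expr2.
have -> : `|D| * (n%:R ^+ 4 * `|invmx C| ^+ 2 * `|E|) =
    (n%:R * (`|invmx C| * Num.sqrt (n%:R ^+ 2 * (`|D| * `|E|)))) ^+ 2.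
  by rewrite !exprMn sqr_sqrtr//; ring.
by rewrite lerXn2r ?nnegrE// !mulr_ge0// sqrtr_ge0.
Qed.

(** The constant in [psdmx_sqrt_dist] involves only [C], a root of the root of the limit [A], so it
    is fixed along the filter. *)
Lemma cvg_sqrtmx (T : Type) (F : set_system T) (FF : Filter F) n
    (f : T -> 'M[R]_n) (A : 'M[R]_n) : psdmx A -> A \in unitmx ->
  f x @[x --> F] --> A -> (\forall x \near F, psdmx (f x)) ->
  sqrtmx (f x) @[x --> F] --> sqrtmx A.
Proof.
move=> hA uA fA hf.
have [hB BB] := sqrtmxP hA; have [[tC _] CC] := sqrtmxP hB.
set B := sqrtmx A in hB BB CC tC *; set C := sqrtmx B in CC tC.
have uC : C \in unitmx.
  by move: uA; rewrite -BB -CC !unitmx_mul -!andbA => /andP[].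
set c := n%:R ^+ 4 * `|invmx C| ^+ 2.
have c_ge0 : 0 <= c by rewrite mulr_ge0// exprn_ge0.
apply/cvgrPdist_le => e e0.
(* The divisor is [c + 1] because [c] vanishes for empty matrices. *)
have /cvgrPdist_le/(_ (e / (c + 1))) := fA.
move=> /(_ (divr_gt0 e0 (ltr_wpDl c_ge0 ltr01))) fAe.
near=> x; have [hBx BBx] : psdmx (sqrtmx (f x)) /\
    sqrtmx (f x) *m sqrtmx (f x) = f x by apply: sqrtmxP; near: x.
rewrite distrC (le_trans (psdmx_sqrt_dist hBx _ tC CC uC))//.
  by have [] := hB.
rewrite BBx BB -/c distrC (@le_trans _ _ (c * (e / (c + 1))))//.
  by rewrite ler_wpM2l//; near: x.
by rewrite mulrCA ler_piMr ?(ltW e0)// ler_pdivrMr ?ltr_wpDl// mul1r lerDl.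
Unshelve. all: by end_near.
Qed.
End SquareRootDistance.

(** * Continuity of products, inverses and frames on a set *)

Section Continuity.
Context {R : realType} (A : set R).

Lemma within_continuous_mulmx m n p (f : R -> 'M[R]_(m, n))
    (g : R -> 'M[R]_(n, p)) :
  {within A, continuous f} -> {within A, continuous g} ->
  {within A, continuous (fun t => f t *m g t)}.
Proof.
move=> /subspace_continuousP fc /subspace_continuousP gc.
apply/subspace_continuousP => t At.
by apply: cvg_mulmx; [exact: fc|exact: gc].
Qed.

Lemma within_continuous_invmx n (f : R -> 'M[R]_n) :
  (forall t, A t -> f t \in unitmx) ->
  {within A, continuous f} -> {within A, continuous (fun t => invmx (f t))}.
Proof.
move=> uf /subspace_continuousP fc; apply/subspace_continuousP => t At.
apply: cvg_invmx; [exact: uf|exact: fc|].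
by apply: filterS (withinT _ _) => // x; exact: uf.
Qed.

Lemma within_continuous_Zmx n (Y : R -> 'M[R]_(n + n, n)) :
  (forall t, A t -> lagrangian (Y t)) ->
  {within A, continuous Y} -> {within A, continuous (fun t => Zmx (Y t))}.
Proof.
move=> hY Yc; have := Yc => /subspace_continuousP Yt.
have Kc : {within A, continuous
    (fun t => invmx (sqrtmx ((Y t)^T *m Y t)))}.
  apply: within_continuous_invmx => [t At|].
    exact/sqrtmx_gram_unit/hY.
  apply/subspace_continuousP => t At; apply: cvg_sqrtmx.
  - exact: psdmx_gram.
  - by apply: gram_unitmx; have [] := hY _ At.
  - by apply: cvg_mulmx; [apply: cvg_trmx|]; exact: Yt.
  - by apply: nearW => x; exact: psdmx_gram.
apply/subspace_continuousP => t At.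
have /subspace_continuousP/(_ _ At) YK := within_continuous_mulmx Yc Kc.
rewrite /Zmx; apply: cvg_row_mx; last exact: YK.
under eq_cvg do rewrite -mulmxA.
by rewrite -mulmxA; apply: cvg_mulmx; [exact: cvg_cst|exact: YK].
Qed.

End Continuity.

(** * Transport of admissible systems by a lower triangular path *)

Section Transformation.
Context {R : realType} {n : nat}.
Variables (a b : R) (Y1 Y2 : R -> 'M[R]_(n + n, n)) (L : R -> 'M[R]_(n + n)).
Hypotheses (hY1 : forall t, t \in `[a, b] -> lagrangian (Y1 t))
  (hL : forall t, t \in `[a, b] -> symplectic (L t))
  (Lc : {within `[a, b], continuous L})
  (L0 : forall t, t \in `[a, b] -> ursubmx (L t) = 0)
  (Y12 : forall t, t \in `[a, b] -> Y2 t = L t *m Y1 t).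

Lemma node_itv s k : itv_partition a b s -> (k <= size s)%N ->
  node a s k \in `[a, b].
Proof.
(* The index stays within [a :: s], so the default of [nth] can be switched from [a] to [b]. *)
move=> hs ks; rewrite /node (set_nth_default b)//= in_itv /=.
by rewrite itv_partition_nth_ge// itv_partition_nth_le.
Qed.

Lemma node_subitv s k : itv_partition a b s -> (k < size s)%N ->
  forall t, t \in `[node a s k, node a s k.+1] -> t \in `[a, b].
Proof.
move=> hs ks t; have := node_itv hs (ltnW ks); have := node_itv hs ks.
rewrite !in_itv /= => /andP[_ h1] /andP[h2 _] /andP[h3 h4].
by rewrite (le_trans h2 h3) (le_trans h4 h1).
Qed.

Lemma osc_system_lower s Rs : osc_system Y1 a b s Rs ->
  osc_system Y2 a b s (fun k t => L t *m Rs k t).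
Proof.
move=> [hs hk]; split=> // k ks I.
have sub := node_subitv hs ks.
have [Rsymp Rc rW rX] := hk k ks; split.
- by move=> t tI; apply: symplectic_mul; [exact/hL/sub|exact: Rsymp].
- apply: within_continuous_mulmx => //.
  by apply: continuous_subspaceW Lc => t /=; exact: sub.
- move=> t u tI uI; rewrite !Y12 ?sub// -!mulmxA.
  rewrite !wronskian_symplectic; first exact: rW.
  + exact/hL/sub.
  + exact/hL/sub.
- have rankL v (B : 'M[R]_(n + n, n)) :
      v \in I -> \rank (usubmx (L v *m B)) = \rank (usubmx B).
    move/sub => vab; rewrite usubmx_lower_mul ?L0// (eqmxMfull _ _)//.
    by rewrite row_full_unit ulsubmx_unit ?L0//; exact/symplectic_unit/hL.
  by move=> t u tI uI; rewrite -!mulmxA !rankL//; exact: rX.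
Qed.

Lemma comp_index_lower t (Yt : 'M[R]_(n + n, n)) : t \in `[a, b] ->
  comp_index (Y2 t) (L t *m Yt) = comp_index (Y1 t) Yt.
Proof.
move=> tab; rewrite /comp_index (Y12 tab).
rewrite (comp_M_lower _ _ (hL tab) (L0 tab)).
by rewrite (comp_P_lower _ (hY1 tab) (hL tab) (L0 tab)).
Qed.

Lemma dual_comp_index_lower t (Yt : 'M[R]_(n + n, n)) : t \in `[a, b] ->
  dual_comp_index (Y2 t) (L t *m Yt) = dual_comp_index (Y1 t) Yt.
Proof.
move=> tab; rewrite /dual_comp_index (Y12 tab).
rewrite (comp_M_lower _ _ (hL tab) (L0 tab)).
by rewrite (comp_P_lower _ (hY1 tab) (hL tab) (L0 tab)).
Qed.

Lemma osc_sum_lower s Rs : itv_partition a b s ->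
  osc_sum Y2 a s (fun k t => L t *m Rs k t) = osc_sum Y1 a s Rs.
Proof.
move=> hs; apply: eq_bigr => k _ /=; rewrite -!mulmxA.
by rewrite !comp_index_lower ?node_itv// ltnW.
Qed.

Lemma dual_osc_sum_lower s Rs : itv_partition a b s ->
  dual_osc_sum Y2 a s (fun k t => L t *m Rs k t) = dual_osc_sum Y1 a s Rs.
Proof.
move=> hs; apply: eq_bigr => k _ /=; rewrite -!mulmxA.
by rewrite !dual_comp_index_lower ?node_itv// ltnW.
Qed.

End Transformation.

(** * Equality of oscillation numbers, using the inverse path *)

Section Equality.
Context {R : realType} {n : nat}.
Variables (a b : R) (Y1 Y2 : R -> 'M[R]_(n + n, n)) (L : R -> 'M[R]_(n + n)).
Hypotheses (hY1 : forall t, t \in `[a, b] -> lagrangian (Y1 t))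
  (hL : forall t, t \in `[a, b] -> symplectic (L t))
  (Lc : {within `[a, b], continuous L})
  (L0 : forall t, t \in `[a, b] -> ursubmx (L t) = 0)
  (Y12 : forall t, t \in `[a, b] -> Y2 t = L t *m Y1 t).

Let hL' t : t \in `[a, b] -> symplectic (invmx (L t)).
Proof. by move=> tab; exact/symplectic_inv/hL. Qed.

Let Lc' : {within `[a, b], continuous (fun t => invmx (L t))}.
Proof. by apply: within_continuous_invmx => // t; move/hL/symplectic_unit. Qed.

(** The invertible upper left block of [L] times the upper block of [L^-1 E] is the upper block of
    [L L^-1 E = E], which is 0. *)
Let L0' t : t \in `[a, b] -> ursubmx (invmx (L t)) = 0.
Proof.
move=> tab; have uL := symplectic_unit (hL tab).
have uA := ulsubmx_unit uL (L0 tab); apply: (can_inj (mulKmx uA)).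
rewrite mulmx0 ursubmx_Emx -usubmx_lower_mul ?L0// mulmxA mulmxV// mul1mx.
by rewrite col_mxKu.
Qed.

Let hY2 t : t \in `[a, b] -> lagrangian (Y2 t).
Proof.
move=> tab; rewrite Y12//.
by apply: lagrangian_symplectic; [exact: hL|exact: hY1].
Qed.

Let Y21 t : t \in `[a, b] -> Y1 t = invmx (L t) *m Y2 t.
Proof. by move=> tab; rewrite Y12// mulKmx//; exact/symplectic_unit/hL. Qed.

(** Both sides apply [xget] to the same set: [L] carries each system of [Y1] to one of [Y2] with the
    same sum, and [L^-1] carries systems back. *)
Lemma osc_lower : osc Y1 a b = osc Y2 a b.
Proof.
apply: (congr1 (xget (0 : int))); apply/seteqP.
split=> N [s [Rs [hs ->]]].
- exists s, (fun k t => L t *m Rs k t); split.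
    exact: (osc_system_lower hL Lc L0 Y12).
  by rewrite (osc_sum_lower hY1 hL L0 Y12)//; case: hs.
- exists s, (fun k t => invmx (L t) *m Rs k t); split.
    exact: (osc_system_lower hL' Lc' L0' Y21).
  by rewrite (osc_sum_lower hY2 hL' L0' Y21)//; case: hs.
Qed.

Lemma dual_osc_lower : dual_osc Y1 a b = dual_osc Y2 a b.
Proof.
apply: (congr1 (xget (0 : int))); apply/seteqP.
split=> N [s [Rs [hs ->]]].
- exists s, (fun k t => L t *m Rs k t); split.
    exact: (osc_system_lower hL Lc L0 Y12).
  by rewrite (dual_osc_sum_lower hY1 hL L0 Y12)//; case: hs.
- exists s, (fun k t => invmx (L t) *m Rs k t); split.
    exact: (osc_system_lower hL' Lc' L0' Y21).
  by rewrite (dual_osc_sum_lower hY2 hL' L0' Y21)//; case: hs.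
Qed.
End Equality.

(** * The lower triangular path from [S] to its orthogonal frame *)

Unset Implicit Arguments.

Theorem theorem3p12 (R : realType) (n : nat) (a b : R) (hab : a <= b)
    (Y : R -> 'M[R]_(n + n, n)) (S : R -> 'M[R]_(n + n))
    (hY : lagrangian_path a b Y)
    (hSc : {within `[a, b], continuous S})
    (hS : forall t, t \in `[a, b] -> symplectic (S t)) :
  osc (fun t => invmx (S t) *m Y t) a b =
    osc (fun t => invmx (Zmx (S t *m Emx)) *m Y t) a b /\
  dual_osc (fun t => invmx (S t) *m Y t) a b =
    dual_osc (fun t => invmx (Zmx (S t *m Emx)) *m Y t) a b.
Proof.
have [_ lagY] := hY; pose Z t := Zmx (S t *m Emx).
have lagSE t : t \in `[a, b] -> lagrangian (S t *m Emx).
  by move=> /hS/lagrangian_Emx.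
have hZ t : t \in `[a, b] -> symplectic (Z t).
  by move=> tab; exact/symplectic_Zmx/lagSE.
have Zc : {within `[a, b], continuous Z}.
  apply: within_continuous_Zmx => [t|]; first exact: lagSE.
  by apply: within_continuous_mulmx => // t; exact: cvg_cst.
pose L t := invmx (Z t) *m S t.
have lagSY t : t \in `[a, b] -> lagrangian (invmx (S t) *m Y t).
  move=> tab; apply: lagrangian_symplectic; last exact: lagY.
  exact/symplectic_inv/hS.
have hL t : t \in `[a, b] -> symplectic (L t).
  move=> tab; apply: symplectic_mul; [|exact: hS].
  exact/symplectic_inv/hZ.
have Lc : {within `[a, b], continuous L}.
  apply: within_continuous_mulmx => //.
  by apply: within_continuous_invmx => // t tab; exact/symplectic_unit/hZ.
have LY t : t \in `[a, b] ->
    invmx (Z t) *m Y t = L t *m (invmx (S t) *m Y t).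
  by move=> tab; rewrite /L -mulmxA mulKVmx//; exact/symplectic_unit/hS.
(* [S E = Z E B] with [B] the square root of the Gram matrix of [S E]. *)
have L0 t : t \in `[a, b] -> ursubmx (L t) = 0.
  move=> tab; have uB := sqrtmx_gram_unit (lagSE _ tab).
  rewrite ursubmx_Emx /L -mulmxA -[S t *m Emx](mulmxKV uB).
  rewrite -Zmx_Emx -/(Z t) !mulmxA mulVmx ?mul1mx;
    last exact/symplectic_unit/hZ.
  by rewrite mul_col_mx mul0mx col_mxKu.
split; first exact: (osc_lower lagSY hL Lc L0).
exact: (dual_osc_lower lagSY hL Lc L0).
Qed.
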